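(* $P(4)=9$. That is, every maximum $4\times 4$ valid board has nine prisoners.
   Context: A configuration on an $n\times n$ board assigns to each of the $n^2$ squares exactly one occupant, either a prisoner or a guard. Two distinct squares are adjacent if one is directly above, below, to the left, to the right, or diagonal to the other (king-move adjacency). A configuration is valid (a valid board) if every square occupied by a prisoner is adjacent to at least as many squares occupied by guards as squares occupied by (other) prisoners. A maximum configuration (maximum board) is a valid board that has the greatest number of prisoners among all valid boards on the $n\times n$ board. $P(n)$ denotes the number of prisoners in a maximum configuration on the $n\times n$ board. *)

(* Defs.v *)
From mathcomp Require Import all_boot.

Set Implicit Arguments.
Unset Strict Implicit.
Unset Printing Implicit Defensive.

(* A square is a pair (row, column). *)
Definition square (n : nat) : finType := ('I_n * 'I_n)%type.

(* A configuration is given by its set of prisoner squares; every other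
   square is occupied by a guard. *)
Definition config (n : nat) : finType := {set square n}.

Definition prisoners n (C : config n) : {set square n} := C.
Definition guards n (C : config n) : {set square n} := ~: prisoners C.

(* King-move adjacency: the row and column indices each differ by at most 1. *)
Definition adjacent n (p q : square n) : bool :=
  [&& p != q,
      p.1 <= q.1.+1, q.1 <= p.1.+1,
      p.2 <= q.2.+1 & q.2 <= p.2.+1].

Definition neighbours n (p : square n) : {set square n} :=
  [set q | adjacent p q].

Definition valid n (C : config n) : bool :=
  [forall p in prisoners C,
     #|neighbours p :&: prisoners C| <= #|neighbours p :&: guards C|].

Definition maximum n (C : config n) : Prop :=
  valid C /\ forall D : config n, valid D -> #|prisoners D| <= #|prisoners C|.

(* The all-guard board is valid, so this maximum ranges over a nonempty
   finite family and is attained. *)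
Definition P (n : nat) : nat :=
  \max_(C : config n | valid C) #|prisoners C|.

(* Main.v *)
Require Import Defs.
From mathcomp Require Import all_boot.

(* The squares of the board are numbered 0, ..., 15 row by row, so that a
   board becomes a word of 16 bits (true = prisoner).  Evaluating all
   2 ^ 16 words bounds the number of prisoners; an explicit word attains nine. *)

(** Reduction modulo 4 makes [cell] total, so no bound on [k] has to be carried; restricted to [k]
    below 16 it is a bijection onto the board. *)
Definition cell (k : nat) : square 4 :=
  (Ordinal (ltn_pmod (k %/ 4) (isT : 0 < 4)), Ordinal (ltn_pmod k (isT : 0 < 4))).

(* Evaluated once here, so that the table is not recomputed for each word. *)
Definition cell_neighbours : seq (seq nat) := Eval vm_compute in
  [seq [seq l <- iota 0 16 | adjacent (cell k) (cell l)] | k <- iota 0 16].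

Definition valid_word (s : bitseq) : bool :=
  all (fun k => nth false s k ==>
         (count (nth false s) (nth [::] cell_neighbours k)
          <= count (predC (nth false s)) (nth [::] cell_neighbours k)))
      (iota 0 16).

Definition word (C : config 4) : bitseq := mkseq (fun k => cell k \in C) 16.

(** The recursion absorbs the prefix into [Q], so no list of words is ever built. *)
Fixpoint all_words (n : nat) (Q : pred bitseq) : bool :=
  if n is m.+1 then
    all_words m (fun s => Q (true :: s)) && all_words m (fun s => Q (false :: s))
  else Q [::].

Lemma all_wordsP (n : nat) (Q : pred bitseq) (s : bitseq) :
  all_words n Q -> size s = n -> Q s.
Proof.
elim: n Q s => [|n IHn] Q [|b s] //= /andP[Qt Qf] [sz_s].
by case: b; [exact: (IHn _ _ Qt) | exact: (IHn _ _ Qf)].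
Qed.

Lemma enum_cell : perm_eq (enum (square 4)) [seq cell k | k <- iota 0 16].
Proof.
apply: uniq_perm; [exact: enum_uniq | by vm_compute | move=> p].
(* The row-major index inverts [cell]: its quotient and remainder by 4 are the row and the
   column. *)
rewrite mem_enum inE; apply/esym/mapP; exists (4 * p.1 + p.2).
  rewrite mem_iota add0n ltnS.
  apply: (@leq_trans (4 * 3 + 3)) => //.
  by apply: leq_add; rewrite ?leq_mul2l -ltnS ltn_ord.
case: p => [i j]; congr pair; apply: val_inj => /=.
  by rewrite mulnC divnMDl // divn_small // addn0 modn_small.
by rewrite mulnC modnMDl modn_small.
Qed.

Lemma card_cell (A : {set square 4}) :
  #|A| = count (fun k => cell k \in A) (iota 0 16).
Proof.
rewrite cardE -(count_map cell (mem A)) -(permP enum_cell) enumT.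
by rewrite -size_filter.
Qed.

Lemma nth_word (C : config 4) (k : nat) :
  k \in iota 0 16 -> nth false (word C) k = (cell k \in C).
Proof. by rewrite mem_iota => lt_k; rewrite nth_mkseq. Qed.

Lemma nth_cell_neighbours (k : nat) : k \in iota 0 16 ->
  nth [::] cell_neighbours k = [seq l <- iota 0 16 | adjacent (cell k) (cell l)].
Proof.
rewrite mem_iota => lt_k.
(* The table is stored as a literal; computation identifies it with its defining formula. *)
have ->: cell_neighbours =
  mkseq (fun k => [seq l <- iota 0 16 | adjacent (cell k) (cell l)]) 16.
  by vm_compute.
by rewrite nth_mkseq.
Qed.

(** The predicate [a] stays free to serve twice: the word itself for prisoners, its complement for
    guards. *)
Lemma card_neighbours_word (C D : config 4) (a : pred nat) (k : nat) :
    k \in iota 0 16 -> {in iota 0 16, forall l, (cell l \in D) = a l} ->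
  #|neighbours (cell k) :&: D| = count a (nth [::] cell_neighbours k).
Proof.
move=> k16 Da; rewrite nth_cell_neighbours // card_cell count_filter.
by apply: eq_in_count => l l16; rewrite /= !inE Da // andbC.
Qed.

Lemma valid_wordE (C : config 4) : valid C = valid_word (word C).
Proof.
have validE k : k \in iota 0 16 ->
  (nth false (word C) k ==>
    (count (nth false (word C)) (nth [::] cell_neighbours k)
     <= count (predC (nth false (word C))) (nth [::] cell_neighbours k))) =
  ((cell k \in prisoners C) ==>
    (#|neighbours (cell k) :&: prisoners C|
     <= #|neighbours (cell k) :&: guards C|)).
  move=> k16; rewrite nth_word //; congr (_ ==> (_ <= _)).
    by apply/esym/card_neighbours_word => // l /nth_word->.
  by apply/esym/card_neighbours_word => // l l16; rewrite inE /= nth_word.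
rewrite /valid_word (eq_in_all validE) /valid.
apply/forallP/allP => [vC k _ | vC p]; first exact: vC.
(* Every square is a [cell], so checking the 16 indices covers the board. *)
have: p \in [seq cell k | k <- iota 0 16].
  by rewrite -(perm_mem enum_cell) mem_enum.
by case/mapP=> k k16 ->; exact: vC.
Qed.

Lemma card_word (C : config 4) : #|prisoners C| = count id (word C).
Proof. by rewrite card_cell count_map. Qed.

Lemma valid_word_count (s : bitseq) :
  size s = 16 -> valid_word s -> count id s <= 9.
Proof.
(* Contrapositive: the exhaustive check is that no word with ten or more prisoners is valid. *)
move=> sz_s; apply/implyP; rewrite implybE orbC -implyNb -ltnNge.
apply: (all_wordsP 16 (fun s => (9 < count id s) ==> ~~ valid_word s)) sz_s.
by vm_compute.
Qed.

Lemma valid_card_le (C : config 4) : valid C -> #|prisoners C| <= 9.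
Proof.
by rewrite valid_wordE card_word; apply: valid_word_count; rewrite size_mkseq.
Qed.

(** The guards split the prisoners into a row of four, a pair and a triple; each prisoner sees at
    most two others, and at most one from a corner. *)
Definition nine_prisoners : bitseq :=
  [:: true;  true;  true;  true;
      false; false; false; false;
      true;  false; true;  true;
      true;  false; true;  false].

Lemma exists_valid_card9 : exists2 C : config 4, valid C & #|prisoners C| = 9.
Proof.
pose C : config 4 :=
    [set p : square 4 | nth false nine_prisoners (4 * p.1 + p.2)].
have wC : word C = nine_prisoners.
  (* Membership in [C] becomes a formula in [k] alone, which can be evaluated. *)
  have -> : word C =
    mkseq (fun k => nth false nine_prisoners (4 * (k %/ 4 %% 4) + k %% 4)) 16.
    by apply: eq_mkseq => k; rewrite inE.
  by vm_compute.
by exists C; rewrite ?valid_wordE ?card_word wC; vm_compute.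
Qed.

Theorem proposition2p4 :
  P 4 = 9 /\ forall C : config 4, maximum C -> #|prisoners C| = 9.
Proof.
have [D vD cD] := exists_valid_card9.
split.
  apply/eqP; rewrite eqn_leq; apply/andP; split.
    by apply/bigmax_leqP => C; exact: valid_card_le.
  by rewrite -cD; exact: leq_bigmax_cond.
move=> C [vC maxC]; apply/eqP; rewrite eqn_leq valid_card_le //=.
by rewrite -cD; exact: maxC.
Qed.
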